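(* There is an absolute constant $C>0$ such that the following holds. Let $p$ be a prime and let $f\in\mathbb{F}_p[X]$ be a polynomial of degree $d\ge 2$. Then for every set $A\subset\mathbb{F}_p$ of size $|A|\le\sqrt{p}$ we have $$|A+A|+|f(A)+f(A)|\ \ge\ C\,|A|^{1+\frac{1}{16\cdot 6^d}}.$$
   Context: For sets $X,Y\subset\mathbb{F}_p$, $X+Y=\{x+y: x\in X,\ y\in Y\}$. For a univariate polynomial $f$, $f(A)=\{f(a): a\in A\}$. $\mathbb{F}_p$ is the field with $p$ elements. *)

(* Defs.v *)
From HB Require Import structures.
From mathcomp Require Import all_boot all_order all_algebra.
Set Implicit Arguments.
Unset Strict Implicit.
Unset Printing Implicit Defensive.
Import GRing.Theory.
Local Open Scope ring_scope.

Definition sumset (V : finZmodType) (X Y : {set V}) : {set V} :=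
  [set x + y | x in X, y in Y].

Definition poly_image (F : finFieldType) (f : {poly F}) (A : {set F}) : {set F} :=
  [set f.[a] | a in A].

(* Main.v *)
Require Import Defs.
From HB Require Import structures.
From mathcomp Require Import all_boot all_order all_algebra.
From mathcomp Require Import all_classical all_reals all_analysis.
From mathcomp Require Import zify ring.
Set Implicit Arguments.
Unset Strict Implicit.
Unset Printing Implicit Defensive.
Import Order.TTheory GRing.Theory Num.Theory.
(* [set0], [subsetP] and the like must denote finite sets. *)
Import boot.fintype boot.finset.
Local Open Scope ring_scope.

(** Suppose that both sumsets have size at most K|A|, and write B = f(A) and
    itdiff k U for the set obtained from U by applying k times U |-> U - U.

    The degree is lowered by differencing.  Since |A - A| <= M|A| with M = K^2,
    many differences t of elements of A are popular: the set A_t of those a in A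
    with a + t in A has at least |A|/(2M) elements.  On A_t the polynomial
    g(x) = f(x + t) - f(x), of degree d - 1, takes its values in B - B, and A_t
    again has a small difference set, with M replaced by 2M^2.  So one step
    squares 2M and replaces B by B - B ([polynomial_bound]).  It needs d < p,
    for otherwise the leading coefficient of g, which is d t times that of f,
    may vanish.

    For quadratic f ([quadratic_bound]) one more differencing gives a linear
    polynomial of slope proportional to t: up to a translation, t A_t lies in a
    fixed dilate of B - B.  By Ruzsa covering ([ruzsa_covering]), t A is then
    covered by few translates of (B - B) - (B - B), for every popular t.
    Popular differences fill a large part T of some translate A - a0, so t T is
    covered as well for every t in T, and so is any sum of boundedly many sets
    of the form t T or -t T.  But in a prime field some sum of six such sets has
    at least |T|^2/2 elements as long as |T|^2 <= p ([six_dilates]).  Hence an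
    iterated difference set of B has size at least |A|^2 divided by a power of M.

    Conversely, the inequality of Petridis ([petridis]) yields Pluennecke's
    bound ([card_itdiff]) of all iterated difference sets of B in terms of
    |B + B|/|B| <= dK, where d enters because f is at most d-to-one.
    Comparing the two estimates gives |A| <= (2dK)^(16 * 2^d)
    ([card_le_doubling]).  The target exponent has 6^d in place of 2^d, and this
    difference absorbs the factor 2d, which makes the constant absolute; for
    d >= p the claim is trivial because then |A| <= d. *)

(** * Sumsets and difference sets *)

Section Sumsets.
Variable V : finZmodType.
Implicit Types (A B C D E U X Y Z : {set V}) (x y z : V) (k n : nat).

Definition diffset X Y : {set V} := [set x - y | x in X, y in Y].

Lemma sumsetP X Y z :
  reflect (exists x y, [/\ x \in X, y \in Y & z = x + y]) (z \in sumset X Y).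
Proof.
apply: (iffP imset2P) => [[x y xX yY ->]|[x [y [xX yY ->]]]].
  by exists x, y.
by exists x y.
Qed.

Lemma diffsetP X Y z :
  reflect (exists x y, [/\ x \in X, y \in Y & z = x - y]) (z \in diffset X Y).
Proof.
apply: (iffP imset2P) => [[x y xX yY ->]|[x [y [xX yY ->]]]].
  by exists x, y.
by exists x y.
Qed.

Lemma mem_sumset X Y x y : x \in X -> y \in Y -> x + y \in sumset X Y.
Proof. by move=> xX yY; apply/sumsetP; exists x, y. Qed.

Lemma mem_diffset X Y x y : x \in X -> y \in Y -> x - y \in diffset X Y.
Proof. by move=> xX yY; apply/diffsetP; exists x, y. Qed.

Lemma sumsetS X X' Y Y' :
  X \subset X' -> Y \subset Y' -> sumset X Y \subset sumset X' Y'.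
Proof. exact: imset2S. Qed.

Lemma diffsetS X X' Y Y' :
  X \subset X' -> Y \subset Y' -> diffset X Y \subset diffset X' Y'.
Proof. exact: imset2S. Qed.

Lemma sumsetA X Y Z : sumset X (sumset Y Z) = sumset (sumset X Y) Z.
Proof.
apply/setP=> w; apply/sumsetP/sumsetP.
  case=> x [_ [xX /sumsetP [y [z [yY zZ ->]]] ->]].
  by exists (x + y), z; rewrite addrA mem_sumset.
case=> _ [z [/sumsetP [x [y [xX yY ->]]] zZ ->]].
by exists x, (y + z); rewrite addrA mem_sumset.
Qed.

Lemma card_sumset_le X Y : (#|sumset X Y| <= #|X| * #|Y|)%N.
Proof. by rewrite -cardsX /sumset curry_imset2X leq_imset_card. Qed.

Lemma leq_card_sumset X Y y : y \in Y -> (#|X| <= #|sumset X Y|)%N.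
Proof.
move=> yY; rewrite -(card_imset (mem X) (addIr y)) subset_leq_card //.
by apply/subsetP=> _ /imsetP [x xX ->]; rewrite mem_sumset.
Qed.

Lemma card_sumset1 X y : #|sumset X [set y]| = #|X|.
Proof.
rewrite -(card_imset (mem X) (addIr y)); congr #|pred_of_set _|.
apply/setP=> z; apply/sumsetP/imsetP => [[x [y' [xX /set1P-> ->]]]|[x xX ->]].
  by exists x.
by exists x, y; rewrite set11.
Qed.

(** Each w in Y - Z has a chosen representation w = y - z; then
    (x, w) |-> (x + y, x + z) is injective, since w and then x can be read off
    from its value. *)
Lemma ruzsa_triangle X Y Z :
  (#|X| * #|diffset Y Z| <= #|sumset X Y| * #|sumset X Z|)%N.
Proof.
pose rep w : V * V :=
  odflt (0, 0) [pick u : V * V | [&& u.1 \in Y, u.2 \in Z & u.1 - u.2 == w]].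
have repP w : w \in diffset Y Z ->
    [/\ (rep w).1 \in Y, (rep w).2 \in Z & (rep w).1 - (rep w).2 = w].
  move=> /diffsetP [y [z [yY zZ wE]]]; rewrite /rep; case: pickP => /=.
    by move=> u /and3P [uY uZ /eqP uE].
  by move/(_ (y, z)); rewrite /= yY zZ wE eqxx.
pose h (u : V * V) := (u.1 + (rep u.2).1, u.1 + (rep u.2).2).
rewrite -!cardsX -(@card_in_imset _ _ h).
  apply/subset_leq_card/subsetP => _ /imsetP [[x w] /setXP [xX wD] ->].
  by have [yY zZ _] := repP _ wD; apply/setXP; rewrite !mem_sumset.
move=> [x w] [x' w'] /setXP [_ wD] /setXP [_ wD'] [/= e1 e2].
have [_ _ wE] := repP _ wD; have [_ _ wE'] := repP _ wD'.
have ww : w = w'.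
  rewrite -wE -wE' -[LHS](addrKA x) -[RHS](addrKA x').
  by rewrite ![_ + x]addrC ![_ + x']addrC e1 e2.
by move: e1; rewrite ww => /addIr ->.
Qed.

(** The hypothesis says that X minimises |Z + B|/|Z| among its own subsets.  The
    set C is built one element c at a time.  Let Z consist of the x in X for
    which x + B + c is already contained in X + B + C'.  Then c adds at most
    |X + B| - |Z + B| elements to X + B + C' and at least |X| - |Z| elements to
    X + C', and minimality compares |Z + B| with |Z|. *)
Lemma petridis X B C :
  (forall Z, Z \subset X -> #|sumset X B| * #|Z| <= #|sumset Z B| * #|X|)%N ->
  (#|sumset (sumset X B) C| * #|X| <= #|sumset X B| * #|sumset X C|)%N.
Proof.
move=> minX; have [n] := ubnP #|C|; elim: n => // n IHn in C *.
have [->|[c cC]] := set_0Vmem C.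
  have -> : sumset (sumset X B) set0 = set0; last by rewrite cards0.
  by apply/setP=> z; rewrite in_set0; apply/sumsetP => -[x [y [_]]]; rewrite in_set0.
rewrite (cardsD1 c) cC ltnS => /IHn; set C' := C :\ c; set Y := sumset X B => {}IHn.
pose Z := [set x in X | [forall b in B, x + b + c \in sumset Y C']].
have ZX : Z \subset X by apply/subsetP=> x; rewrite inE => /andP[].
have C'C : C' \subset C by exact: subD1set.
have card_new : (#|sumset Y C| + #|sumset Z B| <= #|sumset Y C'| + #|Y|)%N.
  have ZY : sumset Z B \subset Y by apply: sumsetS.
  have sub : sumset Y C \subset
      sumset Y C' :|: sumset (Y :\: sumset Z B) [set c].
    apply/subsetP=> _ /sumsetP [y [c' [yY c'C ->]]].
    have [->|c'c] := eqVneq c' c; last first.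
      by apply/setUP; left; rewrite mem_sumset // !inE c'c.
    have [/sumsetP [x [b [xZ bB ->]]]|yZ] := boolP (y \in sumset Z B).
      apply/setUP; left; move: xZ; rewrite inE => /andP [_ /forall_inP]; exact.
    by apply/setUP; right; rewrite mem_sumset ?set11 // inE yZ.
  have := leq_trans (subset_leq_card sub) (leq_card_setU _ _).
  by rewrite card_sumset1; have := cardsID (sumset Z B) Y; rewrite (setIidPr ZY); lia.
have card_old : (#|sumset X C'| + #|X| <= #|sumset X C| + #|Z|)%N.
  have sub : sumset X C' :|: sumset (X :\: Z) [set c] \subset sumset X C.
    rewrite subUset !sumsetS ?subsetDl ?sub1set //.
  have dis : [disjoint sumset X C' & sumset (X :\: Z) [set c]].
    apply/pred0P=> w; apply/negbTE/negP=> /= /andP[/sumsetP [x [c' [xX c'C ->]]]].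
    case/sumsetP=> z [_ [/setDP [zX zZ] /set1P -> zE]].
    case/negP: zZ; rewrite inE zX; apply/forall_inP => b bB.
    by rewrite addrAC -zE addrAC !mem_sumset.
  have := subset_leq_card sub.
  have [_] := leq_card_setU (sumset X C') (sumset (X :\: Z) [set c]).
  rewrite dis => /eqP ->; rewrite card_sumset1.
  by have := cardsID Z X; rewrite (setIidPr ZX); lia.
have := minX Z ZX; rewrite -/Y => minZ.
have := leq_mul card_new (leqnn #|X|); have := leq_mul (leqnn #|Y|) card_old.
rewrite !mulnDl !mulnDr; lia.
Qed.

Fixpoint nsum B n : {set V} := if n is m.+1 then sumset B (nsum B m) else [set 0].

Lemma nsum_add B m n x y :
  x \in nsum B m -> y \in nsum B n -> x + y \in nsum B (m + n).
Proof.
elim: m x => [|m IHm] x /=; first by move/set1P ->; rewrite add0r.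
case/sumsetP=> b [z [bB zB ->]] yB.
by rewrite -addrA mem_sumset // IHm.
Qed.

(** A subset X of B minimising |X + B|/|X| satisfies |X + nB| <= K^n |X| by
    [petridis]; the triangle inequality then bounds mB - nB. *)
Lemma plunnecke B K : B != set0 -> (#|sumset B B| <= K * #|B|)%N ->
  forall m n, (#|diffset (nsum B m) (nsum B n)| <= K ^ (m + n) * #|B|)%N.
Proof.
move=> B0 leK.
pose ratio X : rat := #|sumset X B|%:R / #|X|%:R.
have [X /andP [XB X0] minX] :
    exists2 X : {set V}, (X \subset B) && (X != set0) &
      forall Z : {set V}, (Z \subset B) && (Z != set0) -> ratio X <= ratio Z.
  have PB : (B \subset B) && (B != set0) by rewrite fintype.subxx.
  pose P X := (X \subset B) && (X != set0).
  by case: (@Order.TotalTheory.arg_minP _ _ _ B P ratio PB) => X PX minX; exists X.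
have ratioE Z : Z \subset B -> (#|sumset X B| * #|Z| <= #|sumset Z B| * #|X|)%N.
  move=> ZB; have [->|Z0] := eqVneq Z set0; first by rewrite cards0 muln0.
  have := minX Z; rewrite ZB Z0 => /(_ isT); rewrite /ratio.
  rewrite ler_pdivrMr ?ltr0n ?card_gt0 // mulrAC.
  by rewrite ler_pdivlMr ?ltr0n ?card_gt0 // -!natrM ler_nat.
have card_nsum n : (#|sumset X (nsum B n)| <= K ^ n * #|X|)%N.
  elim: n => [|n IHn]; first by rewrite /= card_sumset1 expn0 mul1n.
  rewrite /= sumsetA; have X_gt0 : (0 < #|X|)%N by rewrite card_gt0.
  have := @petridis X B (nsum B n) (fun Z ZX => ratioE Z (subset_trans ZX XB)).
  have := ratioE B (fintype.subxx _); have B_gt0 : (0 < #|B|)%N by rewrite card_gt0.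
  move=> XBK petr.
  have {XBK}XBK : (#|sumset X B| <= K * #|X|)%N.
    rewrite -(leq_pmul2r B_gt0) (leq_trans XBK) // (leq_trans (leq_mul leK (leqnn _))) //.
    by rewrite mulnAC.
  rewrite -(leq_pmul2r X_gt0) (leq_trans petr) // (leq_trans (leq_mul XBK IHn)) //.
  by rewrite expnS; apply/eq_leq; ring.
move=> m n; have X_gt0 : (0 < #|X|)%N by rewrite card_gt0.
apply: (@leq_trans (K ^ (m + n) * #|X|)); last by rewrite leq_mul2l subset_leq_card ?orbT.
rewrite -(leq_pmul2l X_gt0) (leq_trans (ruzsa_triangle _ _ _)) //.
rewrite (leq_trans (leq_mul (card_nsum m) (card_nsum n))) //.
by rewrite expnD; apply/eq_leq; ring.
Qed.

(** For k > 0 this is 2^(k-1) U - 2^(k-1) U.  Only differences are iterated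
    because this is how the sets arise: f(x + t) - f(x) lies in D - D when f
    takes its values in D. *)
Definition itdiff k U : {set V} := iter k (fun W => diffset W W) U.

Lemma itdiffS_sub B k : itdiff k.+1 B \subset diffset (nsum B (2 ^ k)) (nsum B (2 ^ k)).
Proof.
elim: k => [|k IHk].
  by rewrite /= diffsetS //; apply/subsetP => b bB;
    rewrite -[b]addr0 mem_sumset ?set11.
apply/subsetP=> _ /diffsetP [u [v [/(subsetP IHk) uD /(subsetP IHk) vD ->]]].
case/diffsetP: uD => a [b [aB bB ->]]; case/diffsetP: vD => c [d [cB dB ->]].
have -> : a - b - (c - d) = (a + d) - (b + c) by rewrite opprB addrACA -opprD.
by rewrite expnS mul2n -addnn mem_diffset ?nsum_add.
Qed.

Lemma card_itdiff B K k : B != set0 -> (#|sumset B B| <= K * #|B|)%N ->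
  (#|itdiff k.+1 B| <= K ^ (2 ^ k.+1) * #|B|)%N.
Proof.
move=> B0 leK; rewrite (leq_trans (subset_leq_card (itdiffS_sub B k))) //.
by rewrite (leq_trans (plunnecke B0 leK _ _)) // addnn -mul2n expnS.
Qed.

Lemma itdiffSr k U : itdiff k.+1 U = itdiff k (diffset U U).
Proof. by rewrite /itdiff iterSr. Qed.

Lemma mem0_itdiff k U : U != set0 -> 0 \in itdiff k.+1 U.
Proof.
case/set0Pn=> u uU; elim: k => [|k IHk] /=; first by rewrite -(subrr u) mem_diffset.
by rewrite -[0]subr0 mem_diffset.
Qed.

Lemma itdiff_subS k U : U != set0 -> itdiff k.+1 U \subset itdiff k.+2 U.
Proof.
move=> U0; apply/subsetP=> u uU; rewrite -[u]subr0.
exact: mem_diffset uU (mem0_itdiff k U0).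
Qed.

Definition covered N E U := exists2 X : {set V}, (#|X| <= N)%N & U \subset sumset X E.

Lemma covered_sub N E E' U U' :
  U' \subset U -> E \subset E' -> covered N E U -> covered N E' U'.
Proof.
move=> UU EE [X leN sX]; exists X => //.
by rewrite (subset_trans UU) // (subset_trans sX) // sumsetS.
Qed.

Lemma covered_diff N N' E E' U U' :
  covered N E U -> covered N' E' U' -> covered (N * N') (diffset E E') (diffset U U').
Proof.
move=> [X leN sX] [X' leN' sX']; exists (diffset X X').
  rewrite (leq_trans _ (leq_mul leN leN')) // -cardsX /diffset curry_imset2X.
  exact: leq_imset_card.
apply/subsetP=> _ /diffsetP [u [u' [/(subsetP sX) /sumsetP [x [e [xX eE ->]]]
  /(subsetP sX') /sumsetP [x' [e' [xX' eE' ->]]] ->]]].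
by rewrite opprD addrACA mem_sumset ?mem_diffset.
Qed.

Lemma covered_card N E U : covered N E U -> (#|U| <= N * #|E|)%N.
Proof.
move=> [X leN sX]; rewrite (leq_trans (subset_leq_card sX)) //.
by rewrite (leq_trans (card_sumset_le _ _)) // leq_mul2r leN orbT.
Qed.

(** Take a maximal X in A such that the translates x - U, for x in X, are
    pairwise disjoint.  They all lie in A - U, which bounds |X|; by maximality
    every a - U meets some x - U, that is, a lies in x + (U - U). *)
Lemma ruzsa_covering A U N : (#|diffset A U| <= N * #|U|)%N -> U != set0 ->
  covered N (diffset U U) A.
Proof.
move=> leN U0; have U_gt0 : (0 < #|U|)%N by rewrite card_gt0.
pose sep X := [forall x in X, forall u in U, forall x' in X, forall u' in U,
  (x - u == x' - u') ==> (x == x')].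
have sepP X : sep X -> forall x u x' u', x \in X -> u \in U -> x' \in X -> u' \in U ->
    x - u = x' - u' -> x = x'.
  move=> sX x u x' u' xX uU xX' uU' /eqP e; apply/eqP; move: e; apply/implyP.
  move/forall_inP/(_ x xX)/forall_inP/(_ u uU): sX.
  by move/forall_inP/(_ x' xX')/forall_inP/(_ u' uU').
pose P X := (X \subset A) && sep X.
have P0 : P set0.
  by rewrite /P sub0set; apply/forall_inP => x; rewrite in_set0.
have [X /maxsetP [/andP [XA sX] maxX] _] := maxset_exists P0.
exists X.
  rewrite -(leq_pmul2r U_gt0) (leq_trans _ leN) //.
  rewrite -cardsX -(@card_in_imset _ _ (fun w : V * V => w.1 - w.2)).
    apply/subset_leq_card/subsetP=> _ /imsetP [[x u] /setXP [xX uU] ->].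
    by rewrite mem_diffset ?(subsetP XA).
  move=> [x u] [x' u'] /setXP [xX uU] /setXP [xX' uU'] /= e.
  have xx := sepP _ sX _ _ _ _ xX uU xX' uU' e.
  by move: e; rewrite xx => /addrI /oppr_inj ->.
apply/subsetP=> a aA.
have [aX|aX] := boolP (a \in X).
  by case/set0Pn: U0 => u uU; rewrite -[a]addr0 mem_sumset // -(subrr u) mem_diffset.
have hit x u u' : x \in X -> u \in U -> u' \in U -> a - u = x - u' ->
    a \in sumset X (diffset U U).
  move=> xX uU uU' e; have -> : a = x + (u - u') by rewrite addrCA -e addrC subrK.
  by rewrite mem_sumset ?mem_diffset.
apply/negPn/negP=> aN; case/negP: aX.
(* If a - U met no x - U, then a could be added to X. *)
have <- : a |: X = X; last by rewrite setU11.
apply: maxX; last exact: subsetUr.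
rewrite /P subUset sub1set aA XA /=.
apply/forall_inP=> x xX; apply/forall_inP=> u uU; apply/forall_inP=> x' xX'.
apply/forall_inP=> u' uU'; apply/implyP=> /eqP e.
case/setU1P: xX e => [->|xX]; case/setU1P: xX' => [->|xX'] e //.
- by case/negP: aN; apply: hit e.
- by case/negP: aN; apply: hit (esym e).
- exact/eqP/(sepP _ sX _ _ _ _ xX uU xX' uU' e).
Qed.

(** When |A - A| <= M|A|, the shift t is called popular if this set has at least
    |A|/(2M) elements. *)
Definition shared A t : {set V} := [set a in A | a + t \in A].

(** The pairs (b, a) in A x A with a given unpopular difference a - b number
    fewer than |A|/(2M), and there are at most M|A| differences; so at most half
    of all pairs have an unpopular difference, and some b = a0 does at least as
    well as the average.  Fixing a0 keeps the popular differences inside a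
    translate of A. *)
Lemma popular_translate A M : A != set0 -> (#|diffset A A| <= M * #|A|)%N ->
  exists2 a0, a0 \in A &
   (#|A| <= 2 * #|[set a in A | #|A| <= 2 * M * #|shared A (a - a0)| ]|)%N.
Proof.
move=> A0 leM; have A_gt0 : (0 < #|A|)%N by rewrite card_gt0.
pose pop t := (#|A| <= 2 * M * #|shared A t|)%N.
pose common b := [set a in A | pop (a - b)].
pose rare b := [set a in A | ~~ pop (a - b)].
have rare_le : (2 * M * \sum_(b in A) #|rare b| <= M * #|A| * #|A|)%N.
  apply: (@leq_trans (2 * M * \sum_(t in diffset A A | ~~ pop t) #|shared A t|)); last first.
    rewrite big_distrr /=; apply: (@leq_trans (\sum_(t in diffset A A | ~~ pop t) #|A|)).
      by apply: leq_sum => t /andP[_]; rewrite /pop -ltnNge => /ltnW.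
    rewrite sum_nat_const leq_mul2r; apply/orP; right; apply: leq_trans leM.
    by apply/subset_leq_card/subsetP => t /andP [].
  rewrite leq_mul2l; apply/orP; right.
  pose S := [set w : V * V | [&& w.1 \in A, w.2 \in A & ~~ pop (w.2 - w.1)]].
  have -> : (\sum_(b in A) #|rare b|)%N = #|S|.
    pose Q b a := (a \in A) && ~~ pop (a - b).
    rewrite -sum1dep_card -(pair_big_dep (mem A) Q (fun _ _ => 1%N)) /=.
    by apply: eq_bigr => b bA; rewrite sum1dep_card.
  rewrite -sum1_card (partition_big (fun w : V * V => w.2 - w.1)
      (fun t => (t \in diffset A A) && ~~ pop t)) /=; last first.
    by move=> [b a]; rewrite inE /= => /and3P [bA aA ->]; rewrite mem_diffset.
  apply: leq_sum => t /andP [tD tN]; rewrite sum1dep_card.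
  rewrite -(@card_in_imset _ _ (fun w : V * V => w.1)).
    apply/subset_leq_card/subsetP=> _ /imsetP [[b a] h ->]; move: h; rewrite !inE /=.
    by case/andP => /and3P [bA aA _] /eqP <-; rewrite bA addrC subrK.
  move=> [b a] [b' a']; rewrite !inE /= => /andP [_ /eqP e] /andP [_ /eqP e'] bb.
  by move: e'; rewrite -e bb => /addIr ->.
case: (posnP M) => [M0|M_gt0].
  move: leM; rewrite M0 mul0n leqn0 cards_eq0 => /eqP D0.
  by case/set0Pn: A0 => a aA; have := mem_diffset aA aA; rewrite D0 in_set0.
apply/exists_inP; apply: contraT; rewrite negb_exists => /forallP none.
have many b : b \in A -> ~~ (#|A| <= 2 * #|common b|)%N.
  by move=> bA; have := none b; rewrite bA.
have big_le : (2 * \sum_(b in A) #|rare b| <= #|A| * #|A|)%N.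
  by rewrite -(leq_pmul2l M_gt0) mulnA [(M * 2)%N]mulnC mulnA.
have : (\sum_(b in A) #|A|.+1 <= \sum_(b in A) 2 * #|rare b|)%N.
  apply: leq_sum => b bA; have := many b bA; rewrite -ltnNge.
  have := cardsID [set a | pop (a - b)] A.
  have -> : A :&: [set a | pop (a - b)] = common b.
    by apply/setP=> a; rewrite !inE.
  have -> : A :\: [set a | pop (a - b)] = rare b.
    by apply/setP=> a; rewrite !inE andbC.
  by move: #|common b| #|rare b| #|A| => c r n; lia.
rewrite sum_nat_const -big_distrr /= => /leq_trans /(_ big_le).
by rewrite leq_pmul2l // ltnn.
Qed.
End Sumsets.

(** * Expansion by dilates in a prime field *)

(** Choose one representative in each fibre of phi.  Every other i in S collides
    with the representative of its fibre, in both orders. *)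
Lemma card_collisions (I J : finType) (phi : I -> J) (S : {set I}) :
  (2 * #|S| <= 2 * #|phi @: S| +
    #|[set w : I * I | [&& w.1 \in S, w.2 \in S, w.1 != w.2 & phi w.1 == phi w.2]]|)%N.
Proof.
set coll := [set w : I * I | _].
pose rep i := odflt i [pick j in S | phi j == phi i].
have repP i : i \in S -> (rep i \in S) && (phi (rep i) == phi i).
  by move=> iS; rewrite /rep; case: pickP => //= /(_ i); rewrite iS eqxx.
have rep_eq i j : i \in S -> phi i = phi j -> rep i = rep j.
  move=> iS e; rewrite /rep e; case: pickP => //= /(_ i).
  by rewrite iS e eqxx.
pose P := rep @: S.
have PS : P \subset S by apply/subsetP=> _ /imsetP [i /repP /andP [? _] ->].
have card_P : (#|P| <= #|phi @: S|)%N.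
  rewrite -(@card_in_imset _ _ phi (mem P)).
    exact/subset_leq_card/imsetS.
  move=> _ _ /imsetP [i iS ->] /imsetP [j jS ->].
  have /andP [_ /eqP ->] := repP i iS; have /andP [_ /eqP ->] := repP j jS.
  exact: rep_eq.
pose u i := (i, rep i); pose v i := (rep i, i).
have sub : u @: (S :\: P) :|: v @: (S :\: P) \subset coll.
  have neq i : i \in S :\: P -> [/\ i \in S, rep i \in S, i != rep i & phi i == phi (rep i)].
    case/setDP=> iS iP; have /andP [rS /eqP ->] := repP i iS; split=> //.
    by apply: contraNneq iP => ->; apply: imset_f.
  apply/subsetP=> w /setUP [] /imsetP [i /neq [iS rS n e] ->]; rewrite inE /= iS rS /=.
    by rewrite n.
  by rewrite eq_sym n eq_sym.
have dis : [disjoint u @: (S :\: P) & v @: (S :\: P)].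
  apply/pred0P=> w /=; apply/negbTE/negP=> /andP [/imsetP [i /setDP [_ iP] ->]].
  by case/imsetP=> j /setDP [jS _] [e _]; case/negP: iP; rewrite e imset_f.
have := subset_leq_card sub; have [_] := leq_card_setU (u @: (S :\: P)) (v @: (S :\: P)).
rewrite dis => /eqP ->.
have uI : injective u by move=> i j [].
have vI : injective v by move=> i j [].
rewrite (card_imset _ uI) (card_imset _ vI).
have := cardsID P S; rewrite (setIidPr PS).
move: card_P; move: #|P| #|S :\: P| #|S| #|coll| #|phi @: S| => a b c d e; lia.
Qed.

Section Dilates.
Variable F : finFieldType.
Implicit Types (c x y : F) (T X Y : {set F}).

Definition dilate c X : {set F} := [set c * x | x in X].

Lemma mem_dilate c X x : x \in X -> c * x \in dilate c X.
Proof. by move=> xX; apply: imset_f. Qed.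

Lemma card_dilate c X : c != 0 -> #|dilate c X| = #|X|.
Proof. by move=> c0; rewrite card_imset //; apply: mulfI. Qed.

Lemma dilateM b c X : dilate b (dilate c X) = dilate (b * c) X.
Proof.
rewrite /dilate -imset_comp; apply: eq_imset => x /=; exact: mulrA.
Qed.

Lemma dilate_diffset c X Y : dilate c (diffset X Y) = diffset (dilate c X) (dilate c Y).
Proof.
apply/setP=> z; apply/imsetP/diffsetP.
  case=> _ /diffsetP [x [y [xX yY ->]]] ->.
  by exists (c * x), (c * y); rewrite !mem_dilate // mulrBr.
case=> _ [_ [/imsetP [x xX ->] /imsetP [y yY ->] ->]].
by exists (x - y); rewrite ?mulrBr // mem_diffset.
Qed.

(** Two distinct elements (x, y) and (x', y') of T x T satisfy
    x + c y = x' + c y' for at most one c, so there are at most |T|^4 collisions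
    over all c.  As |T|^2 <= |F|, some c has at most |T|^2 of them, and for this
    c the map (x, y) |-> x + c y takes at least |T|^2 / 2 values. *)
Lemma dilate_average T : (#|T| ^ 2 <= #|F|)%N ->
  exists c, (#|T| ^ 2 <= 2 * #|sumset T (dilate c T)|)%N.
Proof.
move=> leT; pose S := setX T T.
have card_S : #|S| = (#|T| ^ 2)%N by rewrite cardsX mulnn.
pose phi c (w : F * F) := w.1 + c * w.2.
pose coll c := [set w : (F * F) * (F * F) |
  [&& w.1 \in S, w.2 \in S, w.1 != w.2 & phi c w.1 == phi c w.2]].
have sum_coll : (\sum_c #|coll c| <= #|S| ^ 2)%N.
  have -> : (#|S| ^ 2 = \sum_(w in setX S S) 1)%N by rewrite sum1_card cardsX mulnn.
  under eq_bigr => c _ do rewrite -sum1_card big_mkcond /=.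
  rewrite exchange_big /= [leqRHS]big_mkcond /=; apply: leq_sum => -[[x y] [x' y']] _.
  rewrite -big_mkcond /=.
  have [/setXP [/= wS wS']|wN] := ifPn; last first.
    rewrite big1 // => c; rewrite inE /= => /and3P [wS wS' _].
    by case/negP: wN; apply/setXP.
  rewrite sum1_card; apply/card_le1_eqP => c' c inc' inc.
  have {inc'} : ((x, y), (x', y')) \in coll c' by [].
  have {inc} : ((x, y), (x', y')) \in coll c by [].
  rewrite !inE /= => /and4P [_ _ n /eqP e] /and4P [_ _ _ /eqP e'].
  move: e e'; rewrite /phi /= => e e'.
  have [yy|yy] := eqVneq y y'.
    by case/negP: n; move: e; rewrite yy => /addIr ->.
  apply: (mulIf (x := y - y')); first by rewrite subr_eq0.
  have -> : c * (y - y') = x' - x.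
    by rewrite mulrBr; apply/eqP; rewrite subr_eq addrAC -e addrAC subrr add0r.
  by rewrite mulrBr; apply/esym/eqP; rewrite subr_eq addrAC -e' addrAC subrr add0r.
have [c le_c] : exists c, (#|coll c| <= #|S|)%N.
  apply/existsP; apply: contraT; rewrite negb_exists => /forallP many.
  have : (\sum_(c : F) #|S|.+1 <= \sum_c #|coll c|)%N.
    by apply: leq_sum => c _; rewrite ltnNge many.
  rewrite sum_nat_const => /leq_trans /(_ sum_coll).
  have -> : #|xpredT : pred F| = #|F| by apply: eq_card.
  move: leT; rewrite -card_S.
  have : (0 < #|F|)%N by apply/card_gt0P; exists 0.
  move: #|F| #|S| => a b; nia.
exists c; rewrite -card_S.
have im : phi c @: S \subset sumset T (dilate c T).
  apply/subsetP=> _ /imsetP [[x y] /setXP [xT yT] ->].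
  by rewrite mem_sumset ?mem_dilate.
have := card_collisions (phi c) S; have := subset_leq_card im; move: le_c.
rewrite -/(coll c).
move: #|S| #|coll c| #|phi c @: S| #|sumset _ _| => a b d e; lia.
Qed.

(** The quotient set (T - T)/(T - T), with the division cleared. *)
Definition slope T x := [exists a in T, exists b in T, exists c in T, exists d in T,
  (c != d) && (x * (c - d) == a - b)].

Lemma slopeP T x :
  reflect (exists a b c d, [/\ [/\ a \in T, b \in T, c \in T & d \in T], c != d &
                               x * (c - d) = a - b])
    (slope T x).
Proof.
apply: (iffP exists_inP).
  case=> a aT /exists_inP [b bT /exists_inP [c cT /exists_inP [d dT /andP [cd /eqP e]]]].
  by exists a, b, c, d.
case=> a [b [c [d [[aT bT cT dT] cd e]]]]; exists a => //.
apply/exists_inP; exists b => //; apply/exists_inP; exists c => //.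
by apply/exists_inP; exists d => //; rewrite cd e eqxx.
Qed.

(** A collision u + x v = u' + x v' with v <> v' would exhibit x as a slope. *)
Lemma card_sumset_dilate T x : ~~ slope T x -> #|sumset T (dilate x T)| = (#|T| ^ 2)%N.
Proof.
move=> Nx; rewrite -mulnn -cardsX.
rewrite -(@card_in_imset _ _ (fun w : F * F => w.1 + x * w.2)).
  congr #|pred_of_set _|; apply/setP=> z; apply/sumsetP/imsetP.
    case=> a [_ [aT /imsetP [b bT ->] ->]]; exists (a, b) => //.
    by rewrite in_setX aT.
  by case=> -[a b] /setXP [aT bT] ->; exists a, (x * b); rewrite mem_dilate.
move=> [a b] [a' b'] /setXP [aT bT] /setXP [aT' bT'] /= e.
have [bb|bb] := eqVneq b b'; first by move: e; rewrite bb => /addIr ->.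
case/negP: Nx; apply/slopeP; exists a', a, b, b'; split=> //.
by rewrite mulrBr; apply/eqP; rewrite subr_eq addrAC -e addrAC subrr add0r.
Qed.
End Dilates.

Lemma Fp_ind (p : nat) (P : pred 'F_p) :
  P 0 -> (forall x, P x -> P (x + 1)) -> forall x, P x.
Proof.
move=> P0 P1 x; rewrite -(natr_Zp x); elim: (x : nat) => // n IHn.
by rewrite -addn1 natrD P1.
Qed.

(** If every x is a slope of T, [dilate_average] supplies a slope x with
    |T + xT| >= |T|^2 / 2.  Otherwise, as 0 is a slope and 1 generates F_p
    additively, there is a slope x such that x + 1 is not a slope, and then
    |T + (x + 1)T| = |T|^2.  In both cases x = (a - b)/(c - d), and multiplying
    by c - d turns the large set into a part of
    (a - b) T + (c - d) T + (c - d) T, up to translation; the six dilates are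
    grouped below as nested differences. *)
Lemma six_dilates (p : nat) (T : {set 'F_p}) : prime p ->
  (2 <= #|T|)%N -> (#|T| ^ 2 <= p)%N ->
  exists a b c d, [/\ a \in T, b \in T, c \in T & d \in T] /\
   (#|T| ^ 2 <= 2 * #|diffset (diffset (diffset (dilate a T) (dilate b T))
                               (diffset (dilate d T) (dilate c T)))
                               (diffset (dilate d T) (dilate c T))|)%N.
Proof.
move=> pr T2 Tp.
(* x1 is x or x + 1, according to which of the two cases holds. *)
have [x [x1 [slx x1E bigT]]] : exists x x1, [/\ slope T x, x1 = x \/ x1 = x + 1 &
    (#|T| ^ 2 <= 2 * #|sumset T (dilate x1 T)|)%N].
  have [/forallP all|] := boolP [forall x, slope T x].
    have [|c lec] := @dilate_average _ T; first by rewrite card_Fp.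
    by exists c, c; split => //; left.
  rewrite negb_forall => /existsP [y Ny].
  have : [exists x, slope T x && ~~ slope T (x + 1)].
    apply: contraT; rewrite negb_exists => /forallP none.
    case/negP: Ny; apply: Fp_ind => [|x slx].
      have /card_gt1P [c [d [cT dT cd]]] : (1 < #|T|)%N by [].
      by apply/slopeP; exists c, c, c, d; split=> //; rewrite mul0r subrr.
    by have := none x; rewrite slx negbK.
  case/existsP=> x /andP [slx Nx1]; exists x, (x + 1); split=> //; first by right.
  by rewrite card_sumset_dilate // leq_pmull.
case/slopeP: slx => a [b [c [d [[aT bT cT dT] cd e]]]].
exists a, b, c, d; split=> //; apply: leq_trans bigT _; rewrite leq_mul2l /=.
have cd0 : c - d != 0 by rewrite subr_eq0.
set W := diffset (diffset _ _) _.
have memW u v w z : u \in T -> v \in T -> w \in T ->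
  z = (a - b) * u + (c - d) * v + (c - d) * w -> z \in W.
  move=> uT vT wT ->.
  have -> : (a - b) * u + (c - d) * v + (c - d) * w =
    ((a * u - b * u) - (d * v - c * v)) - (d * w - c * w) by ring.
  by rewrite !mem_diffset ?mem_dilate.
have [t tT] : exists t, t \in T by exists a.
case: x1E => ->.
  rewrite -(card_dilate _ cd0) -(card_imset _ (addIr ((c - d) * t))).
  apply/subset_leq_card/subsetP=> _ /imsetP [_ /imsetP [_ /sumsetP [u [w [uT wT ->]]] ->] ->].
  case/imsetP: wT => v vT ->.
  by apply: (memW v u t) => //; rewrite -e; ring.
rewrite -(card_dilate _ cd0).
apply/subset_leq_card/subsetP=> _ /imsetP [_ /sumsetP [u [_ [uT /imsetP [v vT ->] ->]]] ->].
by apply: (memW v u v) => //; rewrite -e; ring.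
Qed.

(** * Differencing polynomials *)

(** By Taylor expansion the coefficient of degree n of the difference is
    (n + 1) t times the leading coefficient of f; this is where the
    characteristic must not divide the degree. *)
Lemma size_poly_shift_sub (F : fieldType) (f : {poly F}) (n : nat) (t : F) :
  size f = n.+2 -> n.+1%:R != 0 :> F -> t != 0 ->
  size (f \Po ('X + t%:P) - f) = n.+1.
Proof.
move=> szf n0 t0; set g := _ - f.
have gE m : g`_m = \sum_(i < n.+1) (f`_(i.+1 + m) *+ 'C(i.+1 + m, i.+1)) * t ^+ i.+1.
  have taylor : f \Po ('X + t%:P) = \sum_(i < size f) f^`N(i) * t%:P ^+ i.
    rewrite /comp_poly nderiv_taylor; last exact: mulrC.
    rewrite size_map_polyC; apply: eq_bigr => i _; rewrite nderivn_map.
    by rewrite -[_.['X]]/(_ \Po 'X) comp_polyXr.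
  rewrite /g taylor szf big_ord_recl /= nderivn0 mulr1 addrAC subrr add0r coef_sum.
  apply: eq_bigr => i _; rewrite -rmorphXn /= coefMC coef_nderivn.
  by rewrite /bump leq0n add1n.
have gn : g`_n = f`_n.+1 * n.+1%:R * t.
  rewrite gE big_ord_recl /= big1 ?addr0 => [|i _].
    by rewrite add1n bin1 mulr_natr expr1.
  by rewrite nth_default ?mul0rn ?mul0r // szf /bump leq0n; lia.
apply/eqP; rewrite eqn_leq; apply/andP; split.
  apply/leq_sizeP => m nm; rewrite gE big1 // => i _.
  by rewrite nth_default ?mul0rn ?mul0r // szf; lia.
rewrite ltnNge; apply/negP => /leq_sizeP /(_ n (leqnn _)) /eqP.
rewrite gn !mulf_eq0 (negPf n0) (negPf t0) !orbF => /eqP f0.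
have : lead_coef f = 0 by rewrite lead_coefE szf.
by move/eqP; rewrite lead_coef_eq0 -size_poly_eq0 szf.
Qed.

Lemma quadratic_shift_sub (F : fieldType) (f : {poly F}) :
  size f = 3 -> 2%:R != 0 :> F ->
  exists2 c, c != 0 & forall t, exists k, forall x, f.[x + t] - f.[x] = c * t * x + k.
Proof.
move=> szf two0; exists (2%:R * f`_2).
  rewrite mulf_neq0 //; have : lead_coef f != 0 by rewrite lead_coef_eq0 -size_poly_eq0 szf.
  by rewrite lead_coefE szf.
move=> t; exists (f`_1 * t + f`_2 * t ^+ 2) => x.
rewrite !horner_coef szf !big_ord_recr !big_ord0 /= !add0r !expr0 !expr1; ring.
Qed.

(** Each fibre of f consists of roots of f - b. *)
Lemma leq_card_poly_image (F : finFieldType) (f : {poly F}) (A : {set F}) (d : nat) :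
  size f = d.+2 -> (#|A| <= d.+1 * #|poly_image f A|)%N.
Proof.
move=> szf; rewrite -sum1_card (partition_big (horner f) (mem (poly_image f A))) /=; last first.
  by move=> a aA; apply: imset_f.
rewrite mulnC -sum_nat_const; apply: leq_sum => b _.
rewrite sum1dep_card cardE -ltnS -szf.
have szfb : size (f - b%:P) = size f.
  by rewrite size_polyDl // size_polyN szf (leq_ltn_trans (size_polyC_leq1 b)).
rewrite -szfb max_poly_roots ?enum_uniq //.
  by rewrite -size_poly_eq0 szfb szf.
apply/allP=> a; rewrite mem_enum inE => /andP [_ /eqP fa].
by rewrite rootE hornerD hornerN hornerC fa subrr.
Qed.

(** * The lower bound for iterated difference sets *)

Section PrimeField.
Variable p : nat.
Hypothesis p_prime : prime p.
Implicit Types (A D : {set 'F_p}) (f : {poly 'F_p}) (M k : nat).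

Lemma natr_Fp_neq0 n : (0 < n < p)%N -> n%:R != 0 :> 'F_p.
Proof.
case/andP=> n0 np; rewrite -(dvdn_pcharf (pchar_Fp p_prime)).
by apply/negP => /(dvdn_leq n0); rewrite leqNgt np.
Qed.

(** The factor (2M)^12 leaves room: the six dilates are each covered by 2M^2
    translates, and the remaining constants amount to 8 <= 2^6. *)
Lemma quadratic_bound A D M f :
  A != set0 -> (#|diffset A A| <= M * #|A|)%N -> (#|A| ^ 2 <= p)%N -> (0 < M)%N ->
  size f = 3 -> (2 < p)%N -> poly_image f A \subset D ->
  (#|A| ^ 2 <= (2 * M) ^ 12 * #|itdiff 5 D|)%N.
Proof.
move=> A0 leM Ap M0 szf p2 fAD.
have fD a : a \in A -> f.[a] \in D by move=> aA; rewrite (subsetP fAD) ?imset_f.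
have D0 : D != set0 by case/set0Pn: A0 => a aA; apply/set0Pn; exists f.[a]; apply: fD.
have D_gt0 : (0 < #|itdiff 5 D|)%N by apply/card_gt0P; exists 0; apply: mem0_itdiff.
(* Four elements are needed for the set T below to have at least two. *)
have [A3|A4] := leqP #|A| 3.
  apply: (@leq_trans (3 ^ 2)); first by rewrite leq_exp2r.
  apply: (@leq_trans ((2 * 1) ^ 12 * 1)); first by [].
  by rewrite leq_mul // leq_exp2r // leq_pmul2l.
have [a0 a0A popa0] := popular_translate A0 leM.
set P := [set a in A | _] in popa0.
pose T : {set 'F_p} := [set a - a0 | a in P].
have card_T : #|T| = #|P| by rewrite card_imset //; apply: addIr.
have T_le : (#|T| <= #|A|)%N.
  by rewrite card_T; apply/subset_leq_card/subsetP=> a; rewrite inE => /andP [].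
have [c c0 fshift] := quadratic_shift_sub szf (natr_Fp_neq0 (n:=2) p2).
(* For u in A_t, c t u is f(u + t) - f(u) up to a constant that cancels in
   differences; so the covering of A by A_t - A_t, dilated by c t, becomes a
   covering by (D - D) - (D - D). *)
have covT t : t \in T -> covered (2 * M ^ 2) (itdiff 2 D) (dilate (c * t) T).
  case/imsetP=> a; rewrite inE => /andP [aA]; set t' := a - a0 => pop_t ->.
  pose U := shared A t'.
  have UA : U \subset A by apply/subsetP=> x; rewrite inE => /andP [].
  have U0 : U != set0.
    by apply: contraTneq pop_t; rewrite -/U => ->; rewrite cards0 muln0 -ltnNge card_gt0.
  have [|X leX sX] := @ruzsa_covering _ A U (2 * M ^ 2) _ U0.
    rewrite (leq_trans (subset_leq_card (diffsetS (subxx _) UA))) // (leq_trans leM) //.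
    rewrite (_ : 2 * M ^ 2 * #|U| = M * (2 * M * #|U|))%N; last by ring.
    by rewrite leq_mul2l pop_t orbT.
  have [k fk] := fshift t'.
  exists [set c * t' * (x - a0) | x in X]; first by rewrite (leq_trans (leq_imset_card _ _)).
  apply/subsetP=> _ /imsetP [_ /imsetP [b bP ->] ->].
  have bA : b \in A by move: bP; rewrite inE => /andP [].
  have /sumsetP [x [_ [xX /diffsetP [u [v [uU vU ->]]] ->]]] := subsetP sX _ bA.
  have -> : c * t' * (x + (u - v) - a0) = c * t' * (x - a0) +
     ((f.[u + t'] - f.[u]) - (f.[v + t'] - f.[v])) by rewrite !fk; ring.
  move: uU vU; rewrite !inE => /andP [uA utA] /andP [vA vtA].
  apply: mem_sumset; first by apply/imsetP; exists x.
  by apply: mem_diffset; apply: mem_diffset; apply: fD.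
have Tp : (#|T| ^ 2 <= p)%N by rewrite (leq_trans _ Ap) // leq_exp2r.
have T2 : (2 <= #|T|)%N by rewrite card_T; move: popa0 A4; move: #|A| #|P| => m n; lia.
have [a [b [d [e [[aT bT dT eT]]]]]] := six_dilates p_prime T2 Tp.
set W := diffset (diffset _ _) _ => leW.
have covW : covered ((2 * M ^ 2) ^ 6) (itdiff 5 D) (dilate c W).
  have -> : ((2 * M ^ 2) ^ 6 = ((2 * M ^ 2) * (2 * M ^ 2)) * ((2 * M ^ 2) * (2 * M ^ 2))
      * ((2 * M ^ 2) * (2 * M ^ 2)))%N by ring.
  have cov2 x y : x \in T -> y \in T -> covered ((2 * M ^ 2) * (2 * M ^ 2)) (itdiff 3 D)
      (diffset (dilate (c * x) T) (dilate (c * y) T)).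
    by move=> xT yT; apply: covered_diff; apply: covT.
  rewrite /W !dilate_diffset !dilateM.
  apply: (@covered_diff _ _ _ (itdiff 4 D) (itdiff 4 D)).
    by apply: (@covered_diff _ _ _ (itdiff 3 D) (itdiff 3 D)); apply: cov2.
  by apply: covered_sub (cov2 _ _ eT dT) => //; apply: itdiff_subS.
have := covered_card covW; rewrite card_dilate // => leW'.
have {leW leW'} leT := leq_trans leW (leq_mul (leqnn 2) leW').
rewrite -card_T in popa0.
apply: (@leq_trans (4 * #|T| ^ 2)).
  by rewrite -[4%N]/(2 ^ 2)%N -expnMn leq_exp2r.
apply: (leq_trans (leq_mul (leqnn 4) leT)).
rewrite (mulnA 4) (mulnA (4 * 2)) leq_mul2r; apply/orP; right.
rewrite [leqRHS](_ : _ = 2 ^ 3 * (4 * 2 * (2 * M ^ 2) ^ 6))%N; last by ring.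
exact: leq_pmull.
Qed.

(** The factor (2M)^2 on the left makes the induction exact: passing from A to
    A_t replaces 2M by 2(2M^2) = (2M)^2 and loses a factor (2M)^2 in |A|^2. *)
Lemma polynomial_bound k A D M f :
  A != set0 -> (#|diffset A A| <= M * #|A|)%N -> (#|A| ^ 2 <= p)%N -> (0 < M)%N ->
  size f = k.+3 -> (k.+2 < p)%N -> poly_image f A \subset D ->
  ((2 * M) ^ 2 * #|A| ^ 2 <= (2 * M) ^ (14 * 2 ^ k) * #|itdiff (k + 5) D|)%N.
Proof.
elim: k A D M f => [|k IHk] A D M f A0 leM Ap M0 szf kp fAD.
  have := quadratic_bound A0 leM Ap M0 szf kp fAD.
  rewrite -(leq_pmul2l (m := (2 * M) ^ 2)) ?expn_gt0 ?muln_gt0 ?M0 //.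
  by rewrite mulnA -expnD.
have fD a : a \in A -> f.[a] \in D by move=> aA; rewrite (subsetP fAD) ?imset_f.
have D0 : D != set0 by case/set0Pn: A0 => a aA; apply/set0Pn; exists f.[a]; apply: fD.
have D_gt0 : (0 < #|itdiff (k.+1 + 5) D|)%N.
  by apply/card_gt0P; exists 0; rewrite addSn; apply: mem0_itdiff.
(* Four elements are needed below to find a popular t that is not zero. *)
have [A3|A4] := leqP #|A| 3.
  apply: (@leq_trans ((2 * M) ^ 28 * 1)); last first.
    rewrite leq_mul // leq_pexp2l ?muln_gt0 ?M0 // expnS.
    by have : (0 < 2 ^ k)%N; [rewrite expn_gt0 | move: (2 ^ k)%N => m; lia].
  rewrite muln1 -[28%N]/(2 + 26)%N expnD leq_mul2l; apply/orP; right.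
  apply: (@leq_trans (3 ^ 2)); first by rewrite leq_exp2r.
  apply: (@leq_trans (2 ^ 26)); first by [].
  by rewrite leq_exp2r // leq_pmulr.
have [a0 a0A popa0] := popular_translate A0 leM.
set P := [set a in A | _] in popa0.
have /card_gt1P [b [b' [bP bP' bb]]] : (1 < #|P|)%N.
  by move: popa0 A4; move: #|A| #|P| => m n; lia.
have [a [aP aa0]] : exists a, a \in P /\ a != a0.
  by have [ba|ba] := eqVneq b a0; [exists b'; rewrite -ba eq_sym | exists b].
have t0 : a - a0 != 0 by rewrite subr_eq0.
move: aP t0; rewrite inE => /andP [aA]; set t := a - a0 => pop_t t0.
set U := shared A t in pop_t.
have UA : U \subset A by apply/subsetP=> x; rewrite inE => /andP [].
have U0 : U != set0.
  by apply: contraTneq pop_t => ->; rewrite cards0 muln0 -ltnNge card_gt0.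
have := IHk U (diffset D D) (2 * M ^ 2)%N (f \Po ('X + t%:P) - f) U0.
rewrite -itdiffSr -addSn.
have -> : ((2 * (2 * M ^ 2)) = (2 * M) ^ 2)%N by ring.
rewrite -!expnM => IH.
apply: (@leq_trans ((2 * M) ^ (2 * 2) * #|U| ^ 2)).
  rewrite (_ : 2 * 2 = 2 + 2)%N // expnD -mulnA -[in leqRHS]expnMn leq_mul2l leq_exp2r //.
  by rewrite pop_t orbT.
have -> : (14 * 2 ^ k.+1 = 2 * (14 * 2 ^ k))%N by rewrite expnS; ring.
apply: IH.
- rewrite (leq_trans (subset_leq_card (diffsetS UA UA))) // (leq_trans leM) //.
  rewrite (_ : 2 * M ^ 2 * #|U| = M * (2 * M * #|U|))%N; last by ring.
  by rewrite leq_mul2l pop_t orbT.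
- by rewrite (leq_trans _ Ap) // leq_exp2r // subset_leq_card.
- by rewrite muln_gt0 expn_gt0 M0.
- exact: size_poly_shift_sub szf (natr_Fp_neq0 (n:=k.+3) kp) t0.
- exact: ltnW kp.
apply/subsetP=> _ /imsetP [x xU ->]; move: xU; rewrite inE => /andP [xA xtA].
rewrite hornerD hornerN horner_comp hornerD hornerX hornerC.
by apply: mem_diffset; apply: fD.
Qed.
End PrimeField.

(** * Comparison of the two bounds *)

Lemma card_le_doubling (p k K : nat) (f : {poly 'F_p}) (A : {set 'F_p}) :
  prime p -> A != set0 -> (#|A| ^ 2 <= p)%N -> size f = k.+3 -> (k.+2 < p)%N ->
  (#|sumset A A| <= K * #|A|)%N ->
  (#|sumset (poly_image f A) (poly_image f A)| <= K * #|A|)%N ->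
  (#|A| <= (2 * K * k.+2) ^ (16 * 2 ^ k.+2))%N.
Proof.
move=> pr A0 Ap szf kp leA leB; set B := poly_image f A in leB.
have A_gt0 : (0 < #|A|)%N by rewrite card_gt0.
have K_gt0 : (0 < K)%N.
  case/set0Pn: A0 => a /(leq_card_sumset A) /leq_trans /(_ leA).
  by case: (K) => // /(leq_trans A_gt0).
have leD : (#|diffset A A| <= K ^ 2 * #|A|)%N.
  rewrite -(leq_pmul2l A_gt0) (leq_trans (ruzsa_triangle A A A)) //.
  by rewrite (leq_trans (leq_mul leA leA)) //; apply/eq_leq; ring.
have B0 : B != set0.
  by case/set0Pn: A0 => a aA; apply/set0Pn; exists f.[a]; apply: imset_f.
have leBB : (#|sumset B B| <= (K * k.+2) * #|B|)%N.
  by rewrite (leq_trans leB) // -mulnA leq_mul2l (leq_card_poly_image _ szf) orbT.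
have BA : (#|B| <= #|A|)%N by exact: leq_imset_card.
have := polynomial_bound pr A0 leD Ap _ szf kp (subxx _).
rewrite expn_gt0 K_gt0 => /(_ isT) main.
have := card_itdiff (k + 4) B0 leBB; rewrite -addnS => itB.
have {}itB := leq_trans itB (leq_mul (leqnn _) BA).
have {main itB} main := leq_trans main (leq_mul (leqnn _) itB).
have le1 : (#|A| * #|A| <= (2 * K ^ 2) ^ 2 * #|A| ^ 2)%N.
  by rewrite mulnn leq_pmull // !(expn_gt0, muln_gt0) K_gt0.
have {main le1} := leq_trans le1 main; rewrite mulnA leq_pmul2r // => main.
apply: leq_trans main _; set N := (2 * K * k.+2)%N.
have N1 : (2 * K ^ 2 <= N ^ 2)%N.
  rewrite (_ : N ^ 2 = 2 * K ^ 2 * (2 * k.+2 ^ 2))%N; last by rewrite /N; ring.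
  by rewrite leq_pmulr.
have N2 : (K * k.+2 <= N)%N by rewrite /N -mulnA leq_pmull.
have N_gt0 : (0 < N)%N by rewrite !muln_gt0 K_gt0.
apply: (@leq_trans ((N ^ 2) ^ (14 * 2 ^ k) * N ^ (2 ^ (k + 5)))).
  by rewrite leq_mul ?leq_exp2r ?muln_gt0 ?expn_gt0.
rewrite -expnM -expnD leq_pexp2l // expnD !expnS.
by move: (2 ^ k)%N => m; lia.
Qed.

Theorem theorem1 (R : realType) :
  exists C : R, 0 < C /\
    forall (p : nat), prime p ->
    forall (d : nat), (2 <= d)%N ->
    forall f : {poly 'F_p}, size f = d.+1 ->
    forall A : {set 'F_p}, (#|A|%:R : R) <= Num.sqrt (p%:R : R) ->
      C * ((#|A|%:R : R) `^ (1 + 1 / (16 * 6 ^+ d)))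
        <= (#|sumset A A| + #|sumset (poly_image f A) (poly_image f A)|)%N%:R.
Proof.
exists 4^-1; split; first by rewrite invr_gt0.
move=> p pr d d2 f szf A Asqrt; set S := (_ + _)%N.
set E : R := 16 * 6 ^+ d.
have E_gt0 : 0 < E by rewrite mulr_gt0 ?exprn_gt0.
have [A_eq0|A0] := eqVneq A set0.
  rewrite A_eq0 cards0 powR0 ?mulr0 //.
  by rewrite gt_eqF // addr_gt0 ?divr_gt0.
have A_gt0 : (0 < #|A|)%N by rewrite card_gt0.
have Ap : (#|A| ^ 2 <= p)%N.
  rewrite -(ler_nat R) natrX -[leRHS](sqr_sqrtr (ler0n R p)).
  by rewrite ler_pXn2r ?nnegrE ?sqrtr_ge0 ?ler0n.
have AS : (#|A| <= S)%N.
  by case/set0Pn: A0 => a aA; rewrite (leq_trans (leq_card_sumset A aA)) // leq_addr.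
pose T : R := #|A|%:R `^ (1 / E).
have TE : T ^+ (16 * 6 ^ d) = #|A|%:R.
  rewrite -powR_mulrn ?powR_ge0 // -powRrM.
  rewrite (_ : (16 * 6 ^ d)%:R = E); last by rewrite /E natrM natrX.
  by rewrite mul1r mulVf ?gt_eqF // powRr1.
rewrite powRD; last by rewrite pnatr_eq0 -lt0n A_gt0 implybT.
rewrite powRr1 // -/T ler_pdivrMl ?ltr0n //.
have T_ge0 : 0 <= T by exact: powR_ge0.
have A_ge0 : 0 <= #|A|%:R :> R by exact: ler0n.
have ASR : #|A|%:R <= S%:R :> R by rewrite ler_nat.
(* T is |A| to the excess exponent.  For T <= 2 the trivial bound |A| <= S is
   enough. *)
have [T2|T2] := lerP T 2.
  rewrite mulrC; apply: ler_pM => //; apply: le_trans T2 _; exact: ler_nat.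
(* Otherwise |A| <= p <= d, and then T <= 2. *)
have dp : (d < p)%N.
  rewrite ltnNge; apply/negP => pd; move: T2; rewrite ltNge => /negP; apply.
  have E0 : (0 < 16 * 6 ^ d)%N by rewrite muln_gt0 expn_gt0.
  rewrite -(ler_pXn2r E0) ?nnegrE // TE -natrX ler_nat.
  have : (#|A| <= d)%N by rewrite (leq_trans _ (leq_trans Ap pd)) // leq_pmulr.
  move=> /leq_trans; apply; rewrite (leq_trans (ltnW (ltn_expl d (isT : 1 < 2)%N))) //.
  rewrite leq_exp2l // (leq_trans (ltnW (ltn_expl d (isT : 1 < 6)%N))) //.
  by rewrite leq_pmull.
pose K := (S %/ #|A|).+1.
have SK : (S <= K * #|A|)%N by rewrite ltnW // ltn_ceil.
have KS : (K * #|A| <= 2 * S)%N.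
  by rewrite mul2n -addnn mulSn leq_add // leq_trunc_div.
case: d d2 szf dp @E E_gt0 @T TE T_ge0 T2 => [|[|k]] // _ szf dp E E_gt0 T TE T_ge0 T2.
have := @card_le_doubling p k K f A pr A0 Ap szf dp (leq_trans (leq_addr _ _) SK)
  (leq_trans (leq_addl _ _) SK).
rewrite -(ler_nat R) -[leLHS]TE natrX.
rewrite (_ : 16 * 6 ^ k.+2 = 3 ^ k.+2 * (16 * 2 ^ k.+2))%N; last first.
  by rewrite mulnCA -expnMn.
have n_gt0 : (0 < 16 * 2 ^ k.+2)%N by rewrite muln_gt0 expn_gt0.
rewrite exprM (ler_pXn2r n_gt0) ?nnegrE ?exprn_ge0 ?ler0n // => T3.
(* Since T > 2, the surplus power T^(3^d - 1) exceeds d. *)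
have Td : T * k.+2%:R <= T ^+ (3 ^ k.+2).
  rewrite -(prednK (_ : 0 < 3 ^ k.+2)%N) ?expn_gt0 // exprS ler_wpM2l //.
  apply: (@le_trans _ _ (2 ^+ (3 ^ k.+2).-1)); last first.
    by apply: lerXn2r; rewrite ?nnegrE // ltW.
  rewrite -natrX ler_nat (leq_trans (ltnW (ltn_expl _ (isT : 1 < 2)%N))) //.
  rewrite leq_exp2l // -ltnS prednK ?expn_gt0 //.
  exact: ltn_expl.
have TK : T <= 2 * K%:R.
  have := le_trans Td T3; rewrite natrM ler_pM2r ?ltr0n // natrM.
  exact.
have : K%:R * #|A|%:R <= 2 * S%:R :> R by rewrite -!natrM ler_nat.
have := ler_wpM2l A_ge0 TK; rewrite mulrCA => le1 le2; apply: le_trans le1 _.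
rewrite (_ : 4 * S%:R = 2 * (2 * S%:R)); last by ring.
by rewrite ler_pM2l // mulrC.
Qed.
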